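(* Let $\delta>0$ and let $(T_k)_{k\in\mathbb N_0}$ be an increasing sequence of non-negative numbers with $T_0=0$, $$\lim_{k\to\infty}(T_{k+1}-T_k)=\infty\quad\text{and}\quad \lim_{k\to\infty}\frac{e^{T_{2k+2}-T_{2k+1}}}{T_{2k+1}-T_{2k}}=0 .$$ Define $A:[0,\infty)\to\mathbb R^{2\times2}$ by $$A(t)=\begin{pmatrix}-1&\delta\\0&-1\end{pmatrix}\ \text{ for } T_{2k}\le t< T_{2k+1},\qquad A(t)=\begin{pmatrix}-1&0\\0&0\end{pmatrix}\ \text{ for } T_{2k+1}\le t<T_{2k+2},\qquad k\in\mathbb N_0.$$ Then the Bohl spectrum and the Sacker--Sell spectrum of the bounded system $\dot x=A(t)x$ are $$\Sigma_{\rm Bohl}=\{-1\}\quad\text{and}\quad\Sigma_{\rm SS}=[-1,0].$$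
   Context: Let $X(t)$ be the fundamental matrix of $\dot x=A(t)x$ ($A:[0,\infty)\to\mathbb R^{d\times d}$ locally integrable) with $X(0)=\mathds 1$ (identity matrix), and $\overline{\mathbb R}=\mathbb R\cup\{-\infty,\infty\}$. Bohl spectrum: for $\xi\in\mathbb R^d\setminus\{0\}$, $\Sigma_\xi$ is the set of all $\lambda\in\overline{\mathbb R}$ for which there are sequences $t_n,s_n\in[0,\infty)$ with $t_n-s_n\to\infty$ and $\lim_{n\to\infty}\frac1{t_n-s_n}\ln\frac{\|X(t_n)\xi\|}{\|X(s_n)\xi\|}=\lambda$; $\Sigma_{\rm Bohl}=\bigcup_{\xi\neq0}\Sigma_\xi$. Exponential dichotomy: the equation admits an exponential dichotomy with growth rate $\gamma\in\mathbb R$ if there are a projector $P\in\mathbb R^{d\times d}$ and constants $K\ge1$, $\alpha>0$ with $\|X(t)PX^{-1}(s)\|\le Ke^{(\gamma-\alpha)(t-s)}$ for all $0\le s\le t$ and $\|X(t)(\mathds 1-P)X^{-1}(s)\|\le Ke^{(\gamma+\alpha)(t-s)}$ for all $0\le t\le s$. It admits an exponential dichotomy with growth rate $\infty$ (respectively $-\infty$) if for some $\gamma\in\mathbb R$ it admits one with growth rate $\gamma$ and $P=\mathds 1$ (respectively $P=0$). Sacker--Sell spectrum: $\Sigma_{\rm SS}$ is the set of $\gamma\in\overline{\mathbb R}$ such that the equation does not admit an exponential dichotomy with growth rate $\gamma$. *)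

(* Defs.v *)
From HB Require Import structures.
From mathcomp Require Import all_boot all_order all_algebra.
From mathcomp Require Import all_classical all_reals all_analysis.

Set Implicit Arguments.
Unset Strict Implicit.
Unset Printing Implicit Defensive.

Import Order.TTheory GRing.Theory Num.Theory.
Import numFieldNormedType.Exports.

Local Open Scope classical_set_scope.
Local Open Scope ring_scope.

(* The library norm on matrices is the maximum of the absolute values of the
   entries, hence these definitions. *)
Definition euclid_norm (R : realType) (d : nat) (v : 'cV[R]_d) : R :=
  Num.sqrt (\sum_(i < d) v i 0 ^+ 2).

Definition op_norm (R : realType) (d : nat) (M : 'M[R]_d) : R :=
  sup [set euclid_norm (M *m v) | v in [set v | euclid_norm v <= 1]].

(* Coefficients are functions on R of which only the values on [0, +oo[ matter.
   Solutions are in the sense of Caratheodory: A X is locally integrable and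
   X(t) = 1 + int_0^t A(s) X(s) ds entrywise, so X is locally absolutely
   continuous with X(0) = 1 and X' = A X almost everywhere. *)
Definition fundamental_matrix (R : realType) (d : nat)
    (A X : R -> 'M[R]_d) : Prop :=
  forall t : R, 0 <= t -> forall i j : 'I_d,
    (@lebesgue_measure R).-integrable `[0, t]
      (fun s => ((A s *m X s) i j)%:E) /\
    X t i j = (1%:M : 'M[R]_d) i j +
      \int[@lebesgue_measure R]_(s in `[0, t]) (A s *m X s) i j.

Definition bounded_system (R : realType) (d : nat) (A : R -> 'M[R]_d) : Prop :=
  exists C : R, forall t : R, 0 <= t -> op_norm (A t) <= C.

(* The fundamental matrix is unique on [0, +oo[; below, "exists X" introduces
   it. *)
Definition Bohl_spectrum_at (R : realType) (d : nat) (A : R -> 'M[R]_d)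
    (xi : 'cV[R]_d) : set (\bar R) :=
  [set lambda | exists X : R -> 'M[R]_d, fundamental_matrix A X /\
    exists t s : nat -> R,
      [/\ forall n, 0 <= t n, forall n, 0 <= s n,
          (fun n => t n - s n) @ \oo --> +oo%R &
          (fun n => ((t n - s n)^-1 *
             ln (euclid_norm (X (t n) *m xi) / euclid_norm (X (s n) *m xi)))%:E)
            @ \oo --> lambda]].

Definition Bohl_spectrum (R : realType) (d : nat) (A : R -> 'M[R]_d) :
    set (\bar R) :=
  \bigcup_(xi in [set xi : 'cV[R]_d | xi != 0]) Bohl_spectrum_at A xi.

Definition dichotomy_with (R : realType) (d : nat) (A : R -> 'M[R]_d)
    (gamma : R) (P : 'M[R]_d) : Prop :=
  exists X : R -> 'M[R]_d, fundamental_matrix A X /\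
  P *m P = P /\
  exists K alpha : R, [/\ 1 <= K, 0 < alpha,
    forall s t : R, 0 <= s -> s <= t ->
      op_norm (X t *m P *m invmx (X s)) <=
        K * expR ((gamma - alpha) * (t - s)) &
    forall s t : R, 0 <= t -> t <= s ->
      op_norm (X t *m (1%:M - P) *m invmx (X s)) <=
        K * expR ((gamma + alpha) * (t - s))].

Definition exponential_dichotomy (R : realType) (d : nat) (A : R -> 'M[R]_d)
    (gamma : \bar R) : Prop :=
  match gamma with
  | EFin g => exists P : 'M[R]_d, dichotomy_with A g P
  | +oo%E => exists g : R, dichotomy_with A g 1%:M
  | -oo%E => exists g : R, dichotomy_with A g 0
  end.

Definition Sacker_Sell_spectrum (R : realType) (d : nat) (A : R -> 'M[R]_d) :
    set (\bar R) :=
  [set gamma | ~ exponential_dichotomy A gamma].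

Definition mx22 (R : realType) (a b c d : R) : 'M[R]_2 :=
  \matrix_(i < 2, j < 2)
    if i == 0 then (if j == 0 then a else b) else (if j == 0 then c else d).

(* Main.v *)
Require Import Defs.
From mathcomp Require Import all_boot all_order all_algebra.
From mathcomp Require Import all_classical all_reals all_analysis.
From mathcomp Require Import measurable_realfun.
From mathcomp Require Import ring lra zify.
Import Order.TTheory GRing.Theory Num.Theory.
Import numFieldNormedType.Exports.
Local Open Scope classical_set_scope.
Local Open Scope ring_scope.

(** Multiplying by the factor exp(t) removes the common decay: the fundamental
    matrix is X(t) = exp(-t) M(t), where M has rows (1, delta psi(t)) and
    (0, exp(tau(t))).  Here tau(t) is the time spent in the odd pieces up to
    time t, and psi(t) is the integral of exp(tau) over the even pieces up to
    time t.  This is [switched_solution]; that it solves the equation is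
    [switched_solution_fundamental], and that nothing else does is
    [fundamental_matrix_unique].

    Bohl spectrum.  The ratio condition says that the factor gained by exp(tau)
    over an odd piece is negligible against the length of the even piece just
    before it, and during that even piece psi grows at speed exp(tau).  Hence
    exp(tau) / psi tends to 0 ([expR_tau_negligible]).  As psi' <= exp(tau), the
    logarithmic derivative of 1 + psi tends to 0, so that 1 + psi grows
    subexponentially, uniformly in the initial time ([psi_subexponential]).  The
    norm of M(t) xi is constant if the second coordinate of xi vanishes, and
    comparable with 1 + psi(t) otherwise; in both cases it is subexponential, and
    every exponent of |X xi| is -1 ([subexponential_exponent]).

    Sacker-Sell spectrum.  The entries of X(t) X(s)^-1 are explicit
    ([switched_solution_transition]).  Backwards in time they are at most
    exp(s - t) (2 + delta (s - t)), which gives a dichotomy with P = 0 for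
    every rate below -1; forwards they are at most 2 + delta (t - s), which
    gives a dichotomy with P = 1 for every positive rate.  For a rate g between -1
    and 0 a dichotomy is impossible ([no_dichotomy_between]): a nonzero vector in
    the range of 1 - P would grow at a rate larger than -1, against the
    subexponential growth of M xi, so P = 1; but over an odd piece the
    diagonal entry of X(t) X(s)^-1 for the second coordinate is exactly 1, and
    since odd pieces are arbitrarily long, no decay rate g - alpha < 0 is
    possible. *)

(** * Euclidean and operator norms *)

Lemma euclid_norm_ge0 {R : realType} {d} (v : 'cV[R]_d) : 0 <= euclid_norm v.
Proof. exact: sqrtr_ge0. Qed.

Lemma le_entry_euclid_norm {R : realType} {d} (v : 'cV[R]_d) i :
  `|v i 0| <= euclid_norm v.
Proof.
rewrite -sqrtr_sqr; apply: ler_wsqrtr.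
by rewrite (bigD1 i) //= lerDl sumr_ge0 // => j _; rewrite sqr_ge0.
Qed.

Lemma euclid_norm_le_sum {R : realType} {d} (v : 'cV[R]_d) :
  euclid_norm v <= \sum_i `|v i 0|.
Proof.
rewrite -(ger0_norm (sumr_ge0 _ (fun i _ => normr_ge0 (v i 0)))) -sqrtr_sqr.
apply: ler_wsqrtr; rewrite [leRHS]expr2 mulr_suml ler_sum // => i _.
rewrite -real_normK ?num_real // expr2 ler_wpM2l //.
by rewrite (bigD1 i) //= lerDl sumr_ge0.
Qed.

Lemma euclid_norm_gt0 {R : realType} {d} (v : 'cV[R]_d) :
  v != 0 -> 0 < euclid_norm v.
Proof.
move=> v0; rewrite lt_neqAle euclid_norm_ge0 andbT eq_sym.
apply: contra v0 => /eqP v0; apply/eqP/colP => i; rewrite mxE; apply/eqP.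
by rewrite -normr_le0 -v0 le_entry_euclid_norm.
Qed.

Lemma euclid_normZ {R : realType} {d} (c : R) (v : 'cV[R]_d) :
  euclid_norm (c *: v) = `|c| * euclid_norm v.
Proof.
rewrite /euclid_norm -sqrtr_sqr -sqrtrM ?sqr_ge0 // mulr_sumr.
by congr Num.sqrt; apply: eq_bigr => i _; rewrite mxE exprMn.
Qed.

Lemma euclid_norm0 {R : realType} {d} : euclid_norm (0 : 'cV[R]_d) = 0.
Proof.
by rewrite -(scale0r 0) euclid_normZ normr0 mul0r.
Qed.

Lemma euclid_norm_mul_le {R : realType} {d} (M : 'M[R]_d) (v : 'cV[R]_d) :
  euclid_norm v <= 1 -> euclid_norm (M *m v) <= \sum_i \sum_j `|M i j|.
Proof.
move=> v1; apply: (le_trans (euclid_norm_le_sum _)); apply: ler_sum => i _.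
rewrite mxE; apply: (le_trans (ler_norm_sum _ _ _)); apply: ler_sum => j _.
rewrite normrM ler_piMr //; exact: le_trans (le_entry_euclid_norm _ _) v1.
Qed.

Lemma op_norm_le_sum {R : realType} {d} (M : 'M[R]_d) :
  op_norm M <= \sum_i \sum_j `|M i j|.
Proof.
apply: ge_sup; last by move=> _ [v v1 <-]; exact: euclid_norm_mul_le.
by exists (euclid_norm (M *m 0)), 0 => //=; rewrite euclid_norm0.
Qed.

(** Besides homogeneity this needs that the supremum defining the operator norm
    is over a bounded set, which [euclid_norm_mul_le] provides. *)
Lemma op_norm_bound {R : realType} {d} (M : 'M[R]_d) (v : 'cV[R]_d) :
  euclid_norm (M *m v) <= op_norm M * euclid_norm v.
Proof.
have [->|v0] := eqVneq v 0; first by rewrite mulmx0 euclid_norm0 mulr0.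
have nv := euclid_norm_gt0 _ v0.
have n0 : euclid_norm v != 0 by rewrite gt_eqF.
rewrite mulrC -ler_pdivrMl // -{1}(gtr0_norm nv) -normfV -euclid_normZ scalemxAr.
apply: ub_le_sup.
  by exists (\sum_i \sum_j `|M i j|) => _ [w w1 <-]; exact: euclid_norm_mul_le.
by exists ((euclid_norm v)^-1 *: v) => //=; rewrite euclid_normZ normfV
  gtr0_norm // mulVf.
Qed.

Lemma op_norm0 {R : realType} {d} : op_norm (0 : 'M[R]_d) <= 0.
Proof.
apply: (le_trans (op_norm_le_sum _)).
by rewrite big1 // => i _; rewrite big1 // => j _; rewrite mxE normr0.
Qed.

Lemma mx22_mul {R : realType} (a b c d a' b' c' d' : R) :
  mx22 a b c d *m mx22 a' b' c' d' =
  mx22 (a * a' + b * c') (a * b' + b * d') (c * a' + d * c') (c * b' + d * d').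
Proof.
by apply/matrixP => i j; rewrite !mxE big_ord_recl big_ord1 !mxE /=;
  case: ifP; case: ifP.
Qed.

Lemma op_norm_mx22 {R : realType} (a b c d : R) :
  op_norm (mx22 a b c d) <= `|a| + `|b| + (`|c| + `|d|).
Proof.
apply: (le_trans (op_norm_le_sum _)).
by rewrite !big_ord_recl !big_ord0 !mxE /= !addr0.
Qed.

Lemma mx22_1 {R : realType} : mx22 1 0 0 1 = 1%:M :> 'M[R]_2.
Proof.
by apply/matrixP => i j; rewrite !mxE; case: i => -[|[|//]] ?;
  case: j => -[|[|//]] ?.
Qed.

Lemma mx22_unit {R : realType} (a b d : R) :
  a != 0 -> d != 0 -> mx22 a b 0 d \in unitmx.
Proof.
move=> a0 d0.
suff /mulmx1_unit[] : mx22 a b 0 d *m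
  mx22 a^-1 (- (b / (a * d))) 0 d^-1 = 1%:M by [].
rewrite mx22_mul -mx22_1; congr mx22; field; rewrite ?a0 ?d0 //.
Qed.

Lemma mx22_mulv {R : realType} (a b c d : R) (v : 'cV[R]_2) :
  (mx22 a b c d *m v) 0 0 = a * v 0 0 + b * v 1 0 /\
  (mx22 a b c d *m v) 1 0 = c * v 0 0 + d * v 1 0.
Proof.
have o1 : lift ord0 ord0 = 1 :> 'I_2 by apply/val_inj.
by split; rewrite mxE big_ord_recl big_ord1 !mxE /= o1.
Qed.

Lemma euclid_norm2_le {R : realType} (v : 'cV[R]_2) :
  euclid_norm v <= `|v 0 0| + `|v 1 0|.
Proof.
have o1 : lift ord0 ord0 = 1 :> 'I_2 by apply/val_inj.
by apply: (le_trans (euclid_norm_le_sum _)); rewrite big_ord_recl big_ord1 o1.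
Qed.

(** * Trajectories defined piece by piece *)

Definition breakpoints {R : realType} (T : nat -> R) :=
  [/\ T 0%N = 0, increasing_seq T & forall x, exists k, x < T k].

Lemma breakpoints_of_gaps {R : realType} (T : nat -> R) :
  T 0%N = 0 -> increasing_seq T ->
  (fun k : nat => T k.+1 - T k) @ \oo --> +oo%R -> breakpoints T.
Proof.
move=> T0 Tmono /cvgryPge /(_ 1) [N _ NP]; split=> // x.
have grow n : n%:R <= T (N + n)%N.
  elim: n => [|n IH]; first by rewrite mulr0n -T0 Tmono.
  have := NP (N + n)%N (leq_addr _ _); rewrite addnS -natr1.
  by rewrite /=; lra.
exists (N + Num.bound `|x|)%N; apply: lt_le_trans (grow _).
exact: le_lt_trans (ler_norm x) (archi_boundP (normr_ge0 x)).
Qed.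

Lemma breakpoint_piece {R : realType} (T : nat -> R) N t :
  breakpoints T -> T N <= t -> exists k, [/\ (N <= k)%N, T k <= t & t < T k.+1].
Proof.
move=> [T0 Tmono Tunb] Nt; have /ex_minnP[[|m] tm mmin] := Tunb t.
  by move: (le_lt_trans Nt tm); rewrite ltNge Tmono.
have mt : T m <= t by rewrite leNgt; apply/negP => /mmin; rewrite ltnn.
exists m; split=> //.
by move: (le_lt_trans Nt tm); rewrite ltNge Tmono -ltnNge.
Qed.

Lemma breakpoint_piece_unique {R : realType} (T : nat -> R) t j k :
  increasing_seq T -> T j <= t < T j.+1 -> T k <= t < T k.+1 -> j = k.
Proof.
move=> Tmono /andP[jt tj] /andP[kt tk].
move: (le_lt_trans jt tk) (le_lt_trans kt tj).
by rewrite !ltNge !Tmono -!ltnNge !ltnS => jk kj; apply/eqP; rewrite eqn_leq jk.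
Qed.

(** A transitive relation between times that holds inside each piece holds
    between any two times.  This replaces all inductions over the pieces: it is
    used for monotonicity, for growth bounds and for the integral equation. *)
Lemma chain_pieces {R : realType} (T : nat -> R) (r : R -> R -> Prop) N :
  breakpoints T ->
  (forall s t u, 0 <= s -> s <= t -> t <= u -> r s t -> r t u -> r s u) ->
  (forall k s t, (N <= k)%N -> T k <= s -> s <= t -> t <= T k.+1 -> r s t) ->
  forall s t, T N <= s -> s <= t -> r s t.
Proof.
move=> bT rtrans rpiece s t Ns st.
have [T0 Tmono _] := bT.
have [k [Nk _ /ltW tk]] := breakpoint_piece T N t bT (le_trans Ns st).
rewrite -(subnKC Nk) -addnS in tk.
elim: (k - N).+1 s t Ns st tk => [|n IH] s t Ns st tk.
  rewrite addn0 in tk; apply: (rpiece N) => //.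
  by rewrite (le_trans tk) // Tmono.
have [tn|/ltW nt] := leP t (T (N + n)); first exact: IH.
rewrite addnS in tk.
have [ns|/ltW sn] := leP (T (N + n)) s.
  by apply: (rpiece (N + n)) => //; rewrite leq_addr.
apply: (rtrans _ (T (N + n))) => //.
- by rewrite (le_trans _ Ns) // -T0 Tmono.
- exact: IH.
- by apply: (rpiece (N + n)) => //; rewrite leq_addr.
Qed.

(** Solving piece by piece: [G k x h] is the state reached from [x] after a time
    [h] spent in piece [k], and [F] is the trajectory issued from [x0].  The
    formula for [F] holds at both ends of each piece, so [F] does not jump. *)
Lemma glue_pieces {R : realType} {S : Type} (T : nat -> R)
    (G : nat -> S -> R -> S) (x0 : S) :
  breakpoints T -> (forall k x, G k x 0 = x) ->
  exists F : R -> S, F 0 = x0 /\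
    forall k t, T k <= t -> t <= T k.+1 -> F t = G k (F (T k)) (t - T k).
Proof.
move=> bT G0; have [T0 Tmono _] := bT.
pose fix state n :=
  if n is m.+1 then G m (state m) (T m.+1 - T m) else x0.
have /choice[idx idxP] : forall t, exists k, 0 <= t -> T k <= t < T k.+1.
  move=> t; have [t0|t0] := leP 0 t; last by exists 0%N.
  have [|k [_ kt tk]] := breakpoint_piece T 0 t bT; first by rewrite T0.
  by exists k; rewrite kt.
pose F t := G (idx t) (state (idx t)) (t - T (idx t)).
have T_ge0 k : 0 <= T k by rewrite -T0 Tmono.
have Tlt k : T k < T k.+1 by rewrite ltNge Tmono ltnn.
have idxE k t : T k <= t -> t < T k.+1 -> idx t = k.
  move=> kt tk; apply: (breakpoint_piece_unique T t) => //.
    by apply: idxP; exact: le_trans kt.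
  by rewrite kt.
have FT k : F (T k) = state k by rewrite /F (idxE k) // subrr G0.
exists F; split=> [|k t kt]; first by rewrite -T0 FT.
rewrite le_eqVlt => /predU1P[->|tk]; rewrite FT; first by rewrite FT.
by rewrite /F (idxE k).
Qed.

(** [tau] is the time spent in the odd pieces and [psi] the integral of
    [expR \o tau] over the even ones.  The two-point form allows any time of a
    piece, and not only its left end, to serve as base point. *)
Definition switching_profile {R : realType} (T : nat -> R) (tau psi : R -> R) :=
  [/\ tau 0 = 0, psi 0 = 0 &
    forall k s t, T k <= s -> s <= t -> t <= T k.+1 ->
      if odd k then tau t = tau s + (t - s) /\ psi t = psi s
      else tau t = tau s /\ psi t = psi s + expR (tau s) * (t - s)].

Lemma switching_profile_exists {R : realType} (T : nat -> R) :
  breakpoints T -> exists tau psi, switching_profile T tau psi.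
Proof.
move=> bT.
pose G k (x : R * R) (h : R) : R * R :=
  if odd k then (x.1 + h, x.2) else (x.1, x.2 + expR x.1 * h).
have [|F [F0 FE]] := glue_pieces T G (0, 0) bT.
  by move=> k [a b]; rewrite /G; case: ifP => _ /=; rewrite ?mulr0 addr0.
exists (fun t => (F t).1), (fun t => (F t).2); split; rewrite ?F0 //.
move=> k s t ks st tk.
rewrite (FE k t (le_trans ks st) tk) (FE k s ks (le_trans st tk)) /G.
by case: (odd k) => /=; split=> //; ring.
Qed.

(** Since [tau' <= 1] and [psi' <= expR tau], with [tau] nondecreasing, the value
    of [expR tau] at the later time bounds the mean slope of [psi]. *)
Lemma switching_profile_increment {R : realType} (T : nat -> R) tau psi s t :
  breakpoints T -> switching_profile T tau psi -> 0 <= s -> s <= t ->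
  [/\ tau s <= tau t, tau t <= tau s + (t - s), psi s <= psi t &
      psi t <= psi s + expR (tau t) * (t - s)].
Proof.
move=> bT [_ _ step] s0 st; have [T0 Tmono _] := bT.
pose r s t := [/\ tau s <= tau t, tau t <= tau s + (t - s), psi s <= psi t &
      psi t <= psi s + expR (tau t) * (t - s)].
suff : r s t by [].
apply: (chain_pieces T r 0 bT) => //; last by rewrite T0.
  move=> {s0 st} x y z x0 xy yz [txy1 txy2 pxy1 pxy2] [tyz1 tyz2 pyz1 pyz2].
  split; [lra|lra|lra|].
  have : expR (tau y) * (y - x) <= expR (tau z) * (y - x).
    by rewrite ler_wpM2r ?subr_ge0 // ler_expR.
  lra.
move=> k {s0 st} {}s {}t _ ks st tk; have := step k s t ks st tk.
have es : 0 <= expR (tau s) * (t - s) by rewrite mulr_ge0 ?expR_ge0 ?subr_ge0.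
have et : 0 <= expR (tau t) * (t - s) by rewrite mulr_ge0 ?expR_ge0 ?subr_ge0.
by case: ifP => _ [tauE pE]; rewrite /r pE ?tauE in et *; split; lra.
Qed.

(** * Primitives and the explicit fundamental matrix *)

Lemma FTC_derivable {R : realType} (F f : R -> R) (a b : R) :
  (forall x, is_derive (x : R) (1 : R) F (f x)) -> continuous f -> a <= b ->
  (@lebesgue_measure R).-integrable `[a, b] (EFin \o f) /\
  \int[@lebesgue_measure R]_(x in `[a, b]) f x = F b - F a.
Proof.
move=> dF cf ab; split.
  apply: continuous_compact_integrable; first exact: segment_compact.
  exact: continuous_subspaceT.
move: ab; rewrite le_eqVlt => /predU1P[->|ab].
  by rewrite set_itv1 Rintegral_set1 subrr.
have cF : continuous F.
  by move=> x; apply: differentiable_continuous; apply/derivable1_diffP;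
    exact: ex_derive.
rewrite /Rintegral (continuous_FTC2 ab _ _ _ (F := F)) //.
- exact: continuous_subspaceT.
- split=> [x _| |].
  + exact: ex_derive.
  + by apply: cvg_at_right_filter; exact: cF.
  + by apply: cvg_at_left_filter; exact: cF.
- by move=> x _; rewrite derive1E; exact: derive_val.
Qed.

Lemma integrable_setU_disjoint {d : measure_display} {T : measurableType d}
    {R : realType} (mu : {measure set T -> \bar R}) (A B : set T)
    (f : T -> \bar R) :
  measurable A -> measurable B -> [disjoint A & B] ->
  mu.-integrable A f -> mu.-integrable B f -> mu.-integrable (A `|` B) f.
Proof.
move=> mA mB AB /integrableP[mfA iA] /integrableP[mfB iB].
have mAB := proj2 (measurable_funU _ mA mB) (conj mfA mfB).
apply/integrableP; split=> //; rewrite ge0_integral_setU //.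

  exact: lte_add_pinfty.
exact: measurableT_comp.
Qed.

Lemma disjoint_classical_set {T : Type} (A B : set T) :
  (forall x, A x -> B x -> False) -> [disjoint A & B].
Proof.
move=> AB; rewrite disj_set2E; apply/eqP; rewrite -subset0 => x [].
exact: AB.
Qed.

(** Half-open intervals are used because the coefficient of the equation changes
    at the right end of a piece; they also concatenate without overlap. *)
Definition primitive_on {R : realType} (F f : R -> R) (s t : R) :=
  (@lebesgue_measure R).-integrable `[s, t[ (EFin \o f) /\
  \int[@lebesgue_measure R]_(x in `[s, t[) f x = F t - F s.

Lemma primitive_on_trans {R : realType} (F f : R -> R) s t u :
  s <= t -> t <= u ->
  primitive_on F f s t -> primitive_on F f t u -> primitive_on F f s u.
Proof.
move=> st tu [ist Ist] [itu Itu].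
have E : `[s, u[%classic = `[s, t[ `|` `[t, u[ :> set R.
  by rewrite -itv_bndbnd_setU ?bnd_simp.
have dis : [disjoint `[s, t[%classic & `[t, u[%classic].
  apply: disjoint_classical_set => x /=.
  rewrite !in_itv /= => /andP[_ xt] /andP[tx _].
  by move: (le_lt_trans tx xt); rewrite ltxx.
have isu : (@lebesgue_measure R).-integrable `[s, u[ (EFin \o f).
  by rewrite E; apply: integrable_setU_disjoint.
split=> //; rewrite E Rintegral_setU -?E //.
by rewrite Ist Itu; ring.
Qed.

Lemma primitive_on_closed {R : realType} (F f : R -> R) s t :
  s <= t -> primitive_on F f s t ->
  (@lebesgue_measure R).-integrable `[s, t] (EFin \o f) /\
  F t = F s + \int[@lebesgue_measure R]_(x in `[s, t]) f x.
Proof.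
move=> st [i I]; split; last by rewrite -Rintegral_itv_bndo_bndc // I; ring.
rewrite -(setUitv1 true) ?bnd_simp //; apply: integrable_setU_disjoint => //.
  by apply: disjoint_classical_set => x /= xI xt; move: xI;
    rewrite xt in_itv /= ltxx andbF.
apply/integrableP; split; last by rewrite integral_set1.
exact: measurable_fun_set1.
Qed.

(** On each piece every entry of the solution has the form
    [(a + b * x) * expR (- x) + c]. *)
Lemma primitive_on_affine_exp {R : realType} (a b c : R) (F f : R -> R) s t :
  s <= t ->
  (forall x, s <= x -> x <= t -> F x = (a + b * x) * expR (- x) + c) ->
  (forall x, s <= x -> x < t -> f x = (b - (a + b * x)) * expR (- x)) ->
  primitive_on F f s t.
Proof.
move=> st FE fE.
pose G x : R := (a + b * x) * expR (- x) + c.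
pose g x : R := (b - (a + b * x)) * expR (- x).
have dG x : is_derive (x : R) (1 : R) G (g x).
  apply: is_derive_eq; rewrite /g /GRing.scale /=; ring.
have cg : continuous g.
  move=> x; apply: cvgM.
    by apply: cvgB; [exact: cvg_cst|apply: cvgD; [exact: cvg_cst|
      apply: cvgM; [exact: cvg_cst|exact: cvg_id]]].
  by apply: continuous_comp; [exact: opp_continuous|exact: continuous_expR].
have [ig Ig] := FTC_derivable G g s t dG cg st.
have gf : {in `[s, t[%classic, EFin \o g =1 EFin \o f}.
  by move=> x; rewrite inE /= in_itv /= => /andP[sx xt]; rewrite fE.
have ig' : (@lebesgue_measure R).-integrable `[s, t[ (EFin \o g).
  apply: integrableS ig => // x /=; rewrite !in_itv /= => /andP[-> /ltW].
  by [].
split; first by apply: eq_integrable ig'.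
rewrite (FE s) // (FE t) // -/(G s) -/(G t) -Ig -Rintegral_itv_bndo_bndc //.
by apply: eq_Rintegral => x /gf /= [].
Qed.

Definition switched_coefficient {R : realType} (delta : R) (T : nat -> R)
    (A : R -> 'M[R]_2) :=
  forall k t, T k <= t -> t < T k.+1 ->
    A t = if odd k then mx22 (-1) 0 0 0 else mx22 (-1) delta 0 (-1).

Definition switched_solution {R : realType} (delta : R) (tau psi : R -> R) t :=
  mx22 (expR (- t)) (delta * expR (- t) * psi t) 0 (expR (tau t - t)).

Lemma switched_solution_fundamental {R : realType} delta (T : nat -> R) A
    tau psi :
  breakpoints T -> switched_coefficient delta T A ->
  switching_profile T tau psi ->
  fundamental_matrix A (switched_solution delta tau psi).
Proof.
move=> bT AE [tau0 psi0 step]; have [T0 Tmono _] := bT.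
set X := switched_solution delta tau psi.
move=> t t0 i j.
suff /(primitive_on_closed _ _ _ _ t0) :
    primitive_on (fun s => X s i j) (fun s => (A s *m X s) i j) 0 t.
  have -> : X 0 = 1%:M.
    by rewrite /X /switched_solution tau0 psi0 mulr0 subr0 oppr0 expR0 mx22_1.
  by [].
pose r s t := primitive_on (fun s => X s i j) (fun s => (A s *m X s) i j) s t.
apply: (chain_pieces T r 0) => //; last by rewrite T0.
  by move=> x y z _ xy yz; exact: primitive_on_trans.
move=> k {t0} s {}t _ ks st tk; rewrite /r.
have prof x : s <= x -> x <= t -> if odd k
    then tau x = tau s + (x - s) /\ psi x = psi s
    else tau x = tau s /\ psi x = psi s + expR (tau s) * (x - s).
  by move=> sx xt; apply: (step k) => //; exact: le_trans tk.
have AX x : s <= x -> x < t -> A x *m X x = if odd k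
    then mx22 (- expR (- x)) (- (delta * expR (- x) * psi x)) 0 0
    else mx22 (- expR (- x))
           (- (delta * expR (- x) * psi x) + delta * expR (tau x - x)) 0
           (- expR (tau x - x)).
  move=> sx xt; rewrite (AE k) ?(le_trans ks) ?(lt_le_trans xt) //.
  by case: (odd k); rewrite mx22_mul; congr mx22; ring.
have entry (a b c d : R) : mx22 a b c d i j =
    if i == 0 then (if j == 0 then a else b) else (if j == 0 then c else d).
  by rewrite mxE.
case: (odd k) prof AX => prof AX.
  (* odd piece: [psi] is frozen and [tau x - x] is constant *)
- pose al := if i == 0 then (if j == 0 then 1 else delta * psi s) else 0.
  pose ka := if (i == 0) || (j == 0) then 0 else expR (tau s - s).
  apply: (@primitive_on_affine_exp _ al 0 ka) => // x sx xt.
    have [tauE pE] := prof x sx xt; rewrite /X /switched_solution entry tauE pE.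
    rewrite /al /ka; case: ifP => _; case: ifP => _ /=; try ring.
    by rewrite !mul0r add0r mul0r add0r; congr expR; ring.
  have [_ pE] := prof x sx (ltW xt); rewrite AX // entry pE.
  by rewrite /al; case: ifP => _; case: ifP => _ /=; ring.
  (* even piece: [tau] is frozen and [psi] is affine *)
- pose al := if i == 0 then (if j == 0 then 1 else
      delta * (psi s - expR (tau s) * s)) else
      if j == 0 then 0 else expR (tau s).
  pose be := if (i == 0) && (j != 0) then delta * expR (tau s) else 0.
  apply: (@primitive_on_affine_exp _ al be 0) => // x sx xt.
    have [tauE pE] := prof x sx xt; rewrite /X /switched_solution entry tauE pE.
    by rewrite /al /be expRD; case: ifP => _; case: ifP => _ /=; ring.
  have [tauE pE] := prof x sx (ltW xt); rewrite AX // entry tauE pE expRD.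
  by rewrite /al /be; case: ifP => _; case: ifP => _ /=; ring.
Qed.

(** * Uniqueness of the fundamental matrix *)

Lemma Rintegral_norm_subset {R : realType} (D E : set R) (f : R -> R) :
  measurable D -> measurable E -> D `<=` E ->
  (@lebesgue_measure R).-integrable E (EFin \o f) ->
  \int[@lebesgue_measure R]_(x in D) `|f x| <=
  \int[@lebesgue_measure R]_(x in E) `|f x|.
Proof.
move=> mD mE DE iE; have iN := integrable_norm iE.
apply: fine_le.
- by apply: integrable_fin_num => //; exact: integrableS iN.
- exact: integrable_fin_num.
- by apply: ge0_subset_integral => //; exact: measurable_int iN.
Qed.

Lemma eq0_of_halving {R : realType} (x m : R) :
  (forall n, `|x| <= m / 2 ^+ n) -> x = 0.
Proof.
move=> xm; apply/eqP; rewrite -normr_eq0 -[_ == _]negbK; apply/negP => x0.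
have {}x0 : 0 < `|x| by rewrite lt_neqAle eq_sym x0 normr_ge0.
have m0 : 0 <= m by have := xm 0%N; rewrite expr0 divr1; apply: le_trans.
have nP := archi_boundP (divr_ge0 m0 (ltW x0)).
set n := Num.bound _ in nP.
have := xm n; rewrite leNgt => /negP; apply.
rewrite ltr_pdivrMr ?exprn_gt0 // mulrC -ltr_pdivrMr //.
apply: (lt_le_trans nP); rewrite -natrX ler_nat.
exact/ltnW/ltn_expl.
Qed.

Lemma Rintegral_expR_le {R : realType} (k L t : R) : 0 <= k -> 0 < L -> 0 <= t ->
  (@lebesgue_measure R).-integrable `[0, t] (EFin \o (fun s => k * expR (L * s)))
  /\ \int[@lebesgue_measure R]_(s in `[0, t]) (k * expR (L * s)) <=
     k / L * expR (L * t).
Proof.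
move=> k0 L0 t0.
have [||i ->] := FTC_derivable (fun s => k / L * expR (L * s))
  (fun s => k * expR (L * s)) 0 t _ _ t0.
- move=> x; apply: is_derive_eq; rewrite /GRing.scale /=; field.
  by rewrite gt_eqF.
- move=> x; apply: cvgM; first exact: cvg_cst.
  apply: continuous_comp; last exact: continuous_expR.
  by apply: cvgM; [exact: cvg_cst|exact: cvg_id].
by split=> //; rewrite gerBl mulr_ge0 ?expR_ge0 // divr_ge0 // ltW.
Qed.

(** The Picard map is a contraction of ratio 1/2 for the norm weighted by
    [expR (- L * t)], as soon as [L] is at least twice a bound of the coefficient;
    the difference of two solutions is a fixed point, so it vanishes. *)
Lemma fundamental_matrix_unique {R : realType} {d} (A X Y : R -> 'M[R]_d) C :
  (forall t : R, 0 <= t -> forall i j, `|A t i j| <= C) ->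
  fundamental_matrix A X -> fundamental_matrix A Y ->
  forall t : R, 0 <= t -> X t = Y t.
Proof.
move=> AC fX fY b b0; apply/matrixP => i0 j0; apply/subr0_eq.
have C0 : 0 <= C by apply: le_trans (AC 0 (lexx _) i0 j0).
pose Z s := X s - Y s.
pose f i j s := (A s *m Z s) i j.
have fE i j s : f i j s = (A s *m X s) i j - (A s *m Y s) i j.
  by rewrite /f mulmxBr !mxE.
have intf t i j : 0 <= t ->
    (@lebesgue_measure R).-integrable `[0, t] (EFin \o f i j).
  move=> t0; have [iX _] := fX t t0 i j; have [iY _] := fY t t0 i j.
  apply: (eq_integrable _ _ _ _ (integrableB _ iX iY)) => // s _ /=.
  by rewrite fE EFinB.
have ZE t i j : 0 <= t ->
    Z t i j = \int[@lebesgue_measure R]_(s in `[0, t]) f i j s.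
  move=> t0; have [iX XE] := fX t t0 i j; have [iY YE] := fY t t0 i j.
  under eq_Rintegral do rewrite fE.
  by rewrite RintegralB // /Z !mxE XE YE; ring.
have Z_le t i j : 0 <= t ->
    `|Z t i j| <= \int[@lebesgue_measure R]_(s in `[0, t]) `|f i j s|.
  by move=> t0; rewrite ZE //; apply: le_normr_Rintegral => //; exact: intf.
pose L : R := 2 * (d%:R * C) + 1.
have dC0 : 0 <= d%:R * C by rewrite mulr_ge0.
have L0 : 0 < L by rewrite ltr_wpDl // mulr_ge0.
pose m0 := \sum_i \sum_j \int[@lebesgue_measure R]_(s in `[0, b]) `|f i j s|.
have mij_ge0 i j : 0 <= \int[@lebesgue_measure R]_(s in `[0, b]) `|f i j s|.
  by apply: Rintegral_ge0.
have m0_ge0 : 0 <= m0 by rewrite sumr_ge0 // => i _; rewrite sumr_ge0.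
(* [m0], a sum of integrals over [0, b], bounds the difference on that interval *)
have halving n t i j : 0 <= t -> t <= b ->
    `|Z t i j| <= m0 / 2 ^+ n * expR (L * t).
  elim: n t i j => [|n IH] t i j t0 tb.
    rewrite expr0 divr1; apply: (le_trans (Z_le t i j t0)).
    have e1 : 1 <= expR (L * t) by rewrite -[leLHS]expR0 ler_expR mulr_ge0 // ltW.
    apply: (le_trans _ (ler_peMr m0_ge0 e1)).
    apply: (@le_trans _ _ (\int[@lebesgue_measure R]_(s in `[0, b]) `|f i j s|)).
      apply: Rintegral_norm_subset => //; last first.
        exact/intf/(le_trans t0 tb).
      by apply: subset_itvl; rewrite bnd_simp.
    rewrite /m0 (bigD1 i) //= (bigD1 j) //= -addrA lerDl addr_ge0 ?sumr_ge0 //.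
    by move=> i' _; rewrite sumr_ge0.
  apply: (le_trans (Z_le t i j t0)).
  pose k := d%:R * C * (m0 / 2 ^+ n).
  have k0 : 0 <= k by rewrite mulr_ge0 // divr_ge0.
  have [ik Ik] := Rintegral_expR_le k L t k0 L0 t0.
  apply: (@le_trans _ _
      (\int[@lebesgue_measure R]_(s in `[0, t]) (k * expR (L * s)))).
    apply: le_Rintegral => //.
      exact: integrable_norm (intf t i j t0).
    move=> s /=; rewrite in_itv /= => /andP[s0 st].
    rewrite /f mxE; apply: (le_trans (ler_norm_sum _ _ _)).
    apply: (@le_trans _ _ (\sum_(l < d) C * (m0 / 2 ^+ n * expR (L * s)))).
      apply: ler_sum => l _; rewrite normrM ler_pM //; first exact: AC.
      by apply: IH => //; exact: le_trans tb.
    by rewrite sumr_const card_ord -[leLHS]mulr_natl /k !mulrA.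
  apply: (le_trans Ik); rewrite ler_wpM2r ?expR_ge0 //.
  rewrite ler_pdivrMr // exprSr invfM /k /L.
  set q := m0 / 2 ^+ n.
  have q0 : 0 <= q by rewrite divr_ge0.
  rewrite [m0 * _]mulrA -/q.
  have -> : q / 2 * (2 * (d%:R * C) + 1) = d%:R * C * q + q / 2 by field.
  by rewrite lerDl divr_ge0.
have -> : X b i0 j0 - Y b i0 j0 = Z b i0 j0 by rewrite !mxE.
apply: (@eq0_of_halving _ _ (m0 * expR (L * b))) => n.
by rewrite mulrAC; exact: halving.
Qed.

(** * Subexponential growth of the rescaled solutions *)

(** The constant may depend on [eps] but not on the initial time [s]: Bohl
    exponents let both times vary. *)
Definition subexponential {R : realType} (n : R -> R) :=
  forall eps, 0 < eps -> exists2 K, 0 < K & forall s t, 0 <= s -> s <= t ->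
    n t <= K * expR (eps * (t - s)) * n s /\
    n s <= K * expR (eps * (t - s)) * n t.

Lemma subexponential_comparable {R : realType} (m n : R -> R) c C :
  0 < c -> 0 < C -> (forall t, 0 <= t -> c * m t <= n t <= C * m t) ->
  subexponential m -> subexponential n.
Proof.
move=> c0 C0 mn subm eps eps0; have [K K0 KP] := subm eps eps0.
exists (C * K / c); first by rewrite divr_gt0 // mulr_gt0.
move=> s t s0 st; have t0 := le_trans s0 st.
have [mt ms] := KP s t s0 st.
have /andP[cs sC] := mn s s0; have /andP[ct tC] := mn t t0.
have transfer x y : n x <= C * m x -> c * m y <= n y ->
    m x <= K * expR (eps * (t - s)) * m y ->
    n x <= C * K / c * expR (eps * (t - s)) * n y.
  move=> nx ny xy; apply: (le_trans nx).
  have -> : C * K / c * expR (eps * (t - s)) * n y =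
      C * (K * expR (eps * (t - s)) * (n y / c)) by field; rewrite gt_eqF.
  rewrite ler_pM2l //; apply: (le_trans xy).
  rewrite ler_wpM2l ?mulr_ge0 ?expR_ge0 ?(ltW K0) //.
  by rewrite ler_pdivlMr // mulrC.
by split; exact: transfer.
Qed.

Definition odd_gaps_negligible {R : realType} (T : nat -> R) :=
  (fun k : nat => expR (T (2 * k + 2)%N - T (2 * k + 1)%N) /
                  (T (2 * k + 1)%N - T (2 * k)%N)) @ \oo --> (0 : R).

(** From the end of an even piece to the end of the next one, [tau] increases by
    at most the length of the odd piece in between, whereas [psi] has already
    collected [expR tau] times the length of the first even piece. *)
Lemma expR_tau_negligible {R : realType} (T : nat -> R) tau psi eps :
  breakpoints T -> switching_profile T tau psi ->
  odd_gaps_negligible T ->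
  0 < eps ->
  exists N, forall t, T N <= t -> expR (tau t) <= eps * psi t.
Proof.
move=> bT prof ratio eps0; have [T0 Tmono _] := bT.
have [_ psi0 step] := prof.
have T_ge0 k : 0 <= T k by rewrite -T0 Tmono.
have Tle j k : (j <= k)%N -> T j <= T k by rewrite Tmono.
have [k0 _ k0P] := cvgr0_norm_le _ ratio _ eps0.
exists (2 * k0 + 1)%N => t tN.
(* [t] is put in the union of piece [2 * k + 1] and the even piece after it *)
have [k [k0k tk1 tk3]] : exists k, [/\ (k0 <= k)%N, T (2 * k + 1)%N <= t &
    t <= T (2 * k + 3)%N].
  have [j [Nj jt tj]] := breakpoint_piece T _ t bT tN.
  exists (j.-1)./2; split; first lia.
    by apply: le_trans jt; apply: Tle; lia.
  by apply: (le_trans (ltW tj)); apply: Tle; lia.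
have len_gt0 : 0 < T (2 * k + 1)%N - T (2 * k)%N.
  by rewrite subr_gt0 ltNge Tmono; lia.
have tau_t : tau t <= tau (T (2 * k + 2)%N).
  have [t2|/ltW t2] := leP t (T (2 * k + 2)%N).
    by have [] := switching_profile_increment T tau psi t _ bT prof
      (le_trans (T_ge0 _) tk1) t2.
  have := step (2 * k + 2)%N (T (2 * k + 2)%N) t (lexx _) t2.
  rewrite -addnS => /(_ tk3).
  by rewrite oddD oddM /= => -[-> _].
have [tau1 psi1] : tau (T (2 * k + 1)%N) = tau (T (2 * k)%N) /\
    psi (T (2 * k + 1)%N) = psi (T (2 * k)%N) +
      expR (tau (T (2 * k)%N)) * (T (2 * k + 1)%N - T (2 * k)%N).
  have := step (2 * k)%N _ _ (lexx _) (Tle _ _ (leqnSn _)) (lexx _).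
  by rewrite oddM addn1.
have [tau2 _] : tau (T (2 * k + 2)%N) =
    tau (T (2 * k + 1)%N) + (T (2 * k + 2)%N - T (2 * k + 1)%N) /\
    psi (T (2 * k + 2)%N) = psi (T (2 * k + 1)%N).
  have := step (2 * k + 1)%N _ _ (lexx _) (Tle _ _ (leqnSn _)) (lexx _).
  by rewrite oddD oddM -addnS.
have psi2k : 0 <= psi (T (2 * k)%N).
  by have [_ _ + _] := switching_profile_increment T tau psi 0 _ bT prof (lexx _)
    (T_ge0 (2 * k)%N); rewrite psi0.
have psit : psi (T (2 * k + 1)%N) <= psi t.
  by have [] := switching_profile_increment T tau psi _ t bT prof (T_ge0 _) tk1.
have gap : expR (T (2 * k + 2)%N - T (2 * k + 1)%N) <=
    eps * (T (2 * k + 1)%N - T (2 * k)%N).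
  rewrite -ler_pdivrMr //; apply: le_trans (k0P k k0k); exact: ler_norm.
apply: (@le_trans _ _ (eps * psi (T (2 * k + 1)%N))); last by rewrite ler_pM2l.
rewrite psi1 mulrDr.
apply: (le_trans _ (ler_wpDl (mulr_ge0 (ltW eps0) psi2k) (lexx _))).
apply: (@le_trans _ _ (expR (tau (T (2 * k + 2)%N)))); first by rewrite ler_expR.
rewrite tau2 tau1 expRD mulrCA ler_wpM2l ?expR_ge0 //.
Qed.

(** Beyond some [T N] the slope of [psi] is at most [eps * psi]; on an even piece
    the bound then follows from [1 + x <= expR x], and pieces are chained.  The
    constant [1 + psi (T N)] absorbs the times before [T N]. *)
Lemma psi_subexponential {R : realType} (T : nat -> R) tau psi :
  breakpoints T -> switching_profile T tau psi -> odd_gaps_negligible T ->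
  subexponential (fun t => 1 + psi t).
Proof.
move=> bT prof ratio eps eps0; have [T0 Tmono _] := bT.
have [_ psi0 step] := prof.
have [N NP] := expR_tau_negligible T tau psi eps bT prof ratio eps0.
have TN0 : 0 <= T N by rewrite -T0 Tmono.
have mono s t : 0 <= s -> s <= t -> psi s <= psi t.
  move=> s0 st.
  by have [] := switching_profile_increment T tau psi s t bT prof s0 st.
have psi_ge0 t : 0 <= t -> 0 <= psi t by move=> t0; rewrite -psi0 mono.
pose r s t := 1 + psi t <= expR (eps * (t - s)) * (1 + psi s).
have late s t : T N <= s -> s <= t -> r s t.
  apply: (chain_pieces T r N bT) => {s t}.
    move=> x y z _ _ _ xy yz; apply: (le_trans yz).
    have -> : eps * (z - x) = eps * (z - y) + eps * (y - x) by ring.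
    by rewrite expRD -mulrA ler_wpM2l ?expR_ge0.
  move=> k s t Nk ks st tk; rewrite /r.
  have Ns : T N <= s by apply: le_trans ks; rewrite Tmono.
  have s0 := le_trans TN0 Ns.
  have e1 : 1 + eps * (t - s) <= expR (eps * (t - s)) by exact: expR_ge1Dx.
  apply: (@le_trans _ _ ((1 + eps * (t - s)) * (1 + psi s))); last first.
    by rewrite ler_wpM2r // addr_ge0 ?psi_ge0.
  have := step k s t ks st tk.
  have ts : 0 <= t - s by rewrite subr_ge0.
  case: ifP => _ [_ ->].
    by rewrite ler_peMl ?addr_ge0 ?psi_ge0 // lerDl mulr_ge0 // ltW.
  have : expR (tau s) * (t - s) <= eps * psi s * (t - s).
    by rewrite ler_wpM2r // NP.
  have : 0 <= eps * (t - s) by rewrite mulr_ge0 // ltW.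
  lra.
have K0 : 0 < 1 + psi (T N) by rewrite ltr_wpDr // psi_ge0.
have e1 x : 0 <= x -> 1 <= expR (eps * x).
  by move=> x0; rewrite -[leLHS]expR0 ler_expR mulr_ge0 // ltW.
exists (1 + psi (T N)) => // s t s0 st.
have ps1 : 1 <= 1 + psi s by rewrite lerDl psi_ge0.
have K1 : 1 <= 1 + psi (T N) by rewrite lerDl psi_ge0.
split; last first.
  rewrite -[leLHS]mul1r ler_pM ?(le_trans ler01) ?lerD2l ?mono //.
  by rewrite mulr_ege1 // e1 // subr_ge0.
have [tN|/ltW Nt] := leP t (T N).
  rewrite -mulrA; apply: (@le_trans _ _ (1 + psi (T N))).
    by rewrite lerD2l mono // (le_trans s0).
  by rewrite ler_peMr ?(ltW K0) // mulr_ege1 // e1 // subr_ge0.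
have [sN|/ltW Ns] := leP s (T N).
  apply: (le_trans (late _ _ (lexx _) Nt)).
  apply: (@le_trans _ _ ((1 + psi (T N)) * expR (eps * (t - s)))).
    rewrite mulrC ler_wpM2l ?(ltW K0) // ler_expR.
    by rewrite ler_wpM2l ?(ltW eps0) // lerB.
  by rewrite ler_peMr // mulr_ge0 ?expR_ge0 // ltW.
apply: (le_trans (late _ _ Ns st)); rewrite ler_wpM2r ?(le_trans ler01) //.
by rewrite ler_peMl ?expR_ge0 // lerDl psi_ge0.
Qed.

Lemma expR_tau_le {R : realType} (T : nat -> R) tau psi :
  breakpoints T -> switching_profile T tau psi ->
  odd_gaps_negligible T ->
  exists2 C, 0 < C & forall t, 0 <= t -> expR (tau t) <= C * (1 + psi t).
Proof.
move=> bT prof ratio; have [T0 Tmono _] := bT.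
have [tau0 psi0 _] := prof.
have [N NP] := expR_tau_negligible T tau psi 1 bT prof ratio ltr01.
have inc := switching_profile_increment T tau psi _ _ bT prof.
have TN0 : 0 <= T N by rewrite -T0 Tmono.
have C1 : 1 <= expR (tau (T N)).
  by rewrite -[leLHS]expR0 ler_expR -tau0; case: (inc 0 (T N)).
exists (expR (tau (T N))); first exact: expR_gt0.
move=> t t0.
have psit : 0 <= psi t by have [_ _ + _] := inc 0 t (lexx _) t0; rewrite psi0.
have [tN|/ltW Nt] := leP t (T N).
  apply: (@le_trans _ _ (expR (tau (T N)))).
    by rewrite ler_expR; case: (inc t (T N)).
  by rewrite ler_peMr ?expR_ge0 // lerDl.
apply: (le_trans (NP t Nt)); rewrite mul1r.
have : psi t <= expR (tau (T N)) * psi t by rewrite ler_peMl.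
lra.
Qed.

(** The norm of [expR t *: X t *m xi], see [switched_solution_norm]. *)
Definition rescaled_norm {R : realType} (delta : R) (tau psi : R -> R)
    (xi : 'cV[R]_2) t :=
  euclid_norm (mx22 1 (delta * psi t) 0 (expR (tau t)) *m xi).

Lemma switched_solution_norm {R : realType} (delta : R) tau psi xi t :
  euclid_norm (switched_solution delta tau psi t *m xi) =
  expR (- t) * rescaled_norm delta tau psi xi t.
Proof.
rewrite /rescaled_norm -[X in X * _](ger0_norm (expR_ge0 _)) -euclid_normZ.
congr euclid_norm; rewrite scalemxAl; congr (_ *m _).
apply/matrixP => i j; rewrite !mxE expRD.
by case: ifP => _; case: ifP => _; ring.
Qed.

Lemma rescaled_norm_gt0 {R : realType} (delta : R) tau psi xi t :
  xi != 0 -> 0 < rescaled_norm delta tau psi xi t.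
Proof.
move=> xi0; apply: euclid_norm_gt0; apply: contra xi0 => /eqP M0.
have Mu : mx22 1 (delta * psi t) 0 (expR (tau t)) \in unitmx.
  by apply: mx22_unit; rewrite ?oner_eq0 // gt_eqF ?expR_gt0.
by rewrite -[xi]mul1mx -(mulVmx Mu) -mulmxA M0 mulmx0.
Qed.

(** The first coordinate of [M t *m xi] is
    [xi 0 0 + delta * psi t * xi 1 0] and may vanish when [psi t] is small; there
    the second one, which never drops below [`|xi 1 0|], gives the lower bound. *)
Lemma rescaled_norm_bounds {R : realType} (delta : R) (T : nat -> R) tau psi
    (xi : 'cV[R]_2) :
  0 < delta -> breakpoints T -> switching_profile T tau psi ->
  odd_gaps_negligible T ->
  xi 1 0 != 0 ->
  exists c C, [/\ 0 < c, 0 < C & forall t, 0 <= t ->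
    c * (1 + psi t) <= rescaled_norm delta tau psi xi t <= C * (1 + psi t)].
Proof.
move=> d0 bT prof ratio xi1; have [tau0 psi0 _] := prof.
have [C0 C0_gt0 C0P] := expR_tau_le T tau psi bT prof ratio.
have x1 : 0 < `|xi 1 0| by rewrite normr_gt0.
set r := `|xi 0 0| / `|xi 1 0|.
have r0 : 0 <= r by rewrite divr_ge0.
have den0 : 0 < delta + 1 + r by rewrite ltr_wpDr // addr_gt0.
exists (delta * `|xi 1 0| / (delta + 1 + r)).
exists (`|xi 0 0| + (delta + C0) * `|xi 1 0|); split.
- by rewrite divr_gt0 // mulr_gt0.
- by rewrite ltr_wpDl // mulr_gt0 // addr_gt0.
move=> t t0.
have [tau_ge0 _ psi_ge0 _] := switching_profile_increment T tau psi 0 t bT prof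
  (lexx _) t0.
rewrite tau0 in tau_ge0; rewrite psi0 in psi_ge0.
set n := rescaled_norm _ _ _ _ _.
have [E0 E1] := mx22_mulv 1 (delta * psi t) 0 (expR (tau t)) xi.
rewrite mul1r in E0; rewrite mul0r add0r in E1.
have dp0 : 0 <= delta * psi t by rewrite mulr_ge0 // ltW.
have nu0 : `|delta * psi t * xi 1 0| = delta * psi t * `|xi 1 0|.
  by rewrite normrM ger0_norm.
have nu1 : `|expR (tau t) * xi 1 0| = expR (tau t) * `|xi 1 0|.
  by rewrite normrM ger0_norm ?expR_ge0.
apply/andP; split.
- have n0 : delta * psi t * `|xi 1 0| - `|xi 0 0| <= n.
    apply: (le_trans _ (le_entry_euclid_norm _ 0)).
    rewrite E0 -nu0 [xi 0 0 + _]addrC.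
    exact: lerB_normD.
  have n1 : `|xi 1 0| <= n.
    apply: (le_trans _ (le_entry_euclid_norm _ 1)); rewrite E1 nu1 ler_peMl //.
    by rewrite -[leLHS]expR0 ler_expR.
  have rn : `|xi 0 0| <= r * n.
    by rewrite /r mulrAC ler_pdivlMr // ler_wpM2l.
  have dn : delta * `|xi 1 0| <= delta * n by rewrite ler_pM2l.
  rewrite mulrAC ler_pdivrMr //; lra.
- apply: (le_trans (euclid_norm2_le _)); rewrite E0 E1 nu1.
  have : `|xi 0 0 + delta * psi t * xi 1 0| <=
      `|xi 0 0| + delta * psi t * `|xi 1 0| by rewrite -nu0 ler_normD.
  have : expR (tau t) * `|xi 1 0| <= C0 * (1 + psi t) * `|xi 1 0|.
    by rewrite ler_wpM2r // C0P.
  have : 0 <= `|xi 0 0| * psi t by rewrite mulr_ge0.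
  have : 0 <= delta * `|xi 1 0| by rewrite mulr_ge0 // ltW.
  lra.
Qed.

Lemma rescaled_norm_subexponential {R : realType} (delta : R) (T : nat -> R)
    tau psi xi :
  0 < delta -> breakpoints T -> switching_profile T tau psi ->
  odd_gaps_negligible T ->
  subexponential (rescaled_norm delta tau psi xi).
Proof.
move=> d0 bT prof ratio eps eps0.
have e1 s t : s <= t -> 1 <= expR (eps * (t - s)).
  by move=> st; rewrite -[leLHS]expR0 ler_expR mulr_ge0 ?subr_ge0 // ltW.
have [xi1|xi1] := eqVneq (xi 1 0) 0.
  have nE t : rescaled_norm delta tau psi xi t = euclid_norm xi.
    congr euclid_norm; apply/colP => i.
    have [E0 E1] := mx22_mulv 1 (delta * psi t) 0 (expR (tau t)) xi.
    rewrite xi1 mul1r mulr0 addr0 in E0; rewrite xi1 !mulr0 mul0r addr0 in E1.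
    case: i => -[|[|//]] i2.
      by have -> : Ordinal i2 = 0; [exact/val_inj|exact: E0].
    by have -> : Ordinal i2 = 1; [exact/val_inj|rewrite E1 xi1].
  exists 1 => // s t s0 st; rewrite !nE mul1r.
  by split; rewrite ler_peMl ?euclid_norm_ge0 // e1.
have [c [C [c0 C0 cC]]] :=
  rescaled_norm_bounds _ _ _ _ _ d0 bT prof ratio xi1.
have sub1psi := psi_subexponential T tau psi bT prof ratio.
exact: (subexponential_comparable _ _ c C c0 C0 cC sub1psi eps eps0).
Qed.

(** * Exponents and dichotomies *)

(** With [h = t k - s k], the quotient is [-1] plus the increment of [ln n]
    divided by [h], and the absolute value of that increment is at most
    [`|ln K| + e / 2 * h]. *)
Lemma subexponential_exponent {R : realType} (n : R -> R) (t s : nat -> R) :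
  (forall x, 0 < n x) -> subexponential n ->
  (forall k, 0 <= t k) -> (forall k, 0 <= s k) ->
  (fun k => t k - s k) @ \oo --> +oo%R ->
  (fun k => ((t k - s k)^-1 *
     ln (expR (- t k) * n (t k) / (expR (- s k) * n (s k))))%:E) @ \oo -->
  (-1)%:E.
Proof.
move=> n0 sub t0 s0 ts; apply: cvg_EFin; first by apply: nearW.
rewrite [X in X @ _](_ : _ = fun k => (t k - s k)^-1 *
     ln (expR (- t k) * n (t k) / (expR (- s k) * n (s k)))) //.
apply/cvgrPdist_le => e e0.
have e20 : 0 < e / 2 by rewrite divr_gt0.
have [K K0 KP] := sub _ e20.
have /cvgryPge /(_ (1 + `|ln K| / (e / 2))) [k0 _ k0P] := ts.
exists k0 => // k /k0P; rewrite /mkset => hk.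
set h := t k - s k in hk *.
have lnK : 0 <= `|ln K| / (e / 2) by rewrite divr_ge0 // ltW.
have h0 : 0 < h by apply: lt_le_trans hk; rewrite ltr_wpDr.
have st : s k <= t k by rewrite -subr_ge0 ltW.
have -> : ln (expR (- t k) * n (t k) / (expR (- s k) * n (s k))) =
    - h + (ln (n (t k)) - ln (n (s k))).
  rewrite ln_div ?posrE ?mulr_gt0 ?expR_gt0 //.
  by rewrite !lnM ?posrE ?expR_gt0 // !expRK /h; ring.
have -> : -1 - h^-1 * (- h + (ln (n (t k)) - ln (n (s k)))) =
    - ((ln (n (t k)) - ln (n (s k))) / h) by field; rewrite gt_eqF.
rewrite normrN normrM normfV (gtr0_norm h0) ler_pdivrMr //.
have [up dn] := KP _ _ (s0 k) st.
have ln_le x y : n x <= K * expR (e / 2 * h) * n y ->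
    ln (n x) - ln (n y) <= ln K + e / 2 * h.
  rewrite -ler_ln ?posrE ?mulr_gt0 ?expR_gt0 //.
  rewrite !lnM ?posrE ?mulr_gt0 ?expR_gt0 //.
  by rewrite expRK lerBlDr.
have {}up := ln_le _ _ up; have {}dn := ln_le _ _ dn.
have lnKh : `|ln K| <= e / 2 * h.
  by rewrite mulrC -ler_pdivrMr // (le_trans _ hk) // lerDr.
have lnKabs := ler_norm (ln K).
by rewrite ler_norml; apply/andP; split; lra.
Qed.

(** The affine factor produced by the off-diagonal entry of the transition matrix
    is absorbed by an arbitrarily small loss of exponential rate. *)
Lemma affine_le_expR {R : realType} (a b eta h : R) :
  0 <= a -> 0 <= b -> 0 < eta -> 0 <= h ->
  a + b * h <= (a + b / eta) * expR (eta * h).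
Proof.
move=> a0 b0 eta0 h0; have beta0 : 0 <= b / eta by rewrite divr_ge0 // ltW.
apply: (@le_trans _ _ ((a + b / eta) * (1 + eta * h))); last first.
  by rewrite ler_wpM2l ?addr_ge0 // expR_ge1Dx.
have -> : (a + b / eta) * (1 + eta * h) = a + b * h + (b / eta + a * (eta * h)).
  by field; rewrite gt_eqF.
by rewrite lerDl addr_ge0 // mulr_ge0 // mulr_ge0 // ltW.
Qed.

Lemma switched_solution_transition {R : realType} (delta : R) tau psi s t :
  switched_solution delta tau psi t *m invmx (switched_solution delta tau psi s) =
  mx22 (expR (- (t - s)))
       (delta * (expR (- (t - s)) * ((psi t - psi s) * expR (- tau s))))
       0 (expR (- (t - s) + (tau t - tau s))).
Proof.
set Phi := mx22 _ _ _ _.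
have Xu : switched_solution delta tau psi s \in unitmx.
  by apply: mx22_unit; rewrite gt_eqF ?expR_gt0.
suff -> : switched_solution delta tau psi t =
    Phi *m switched_solution delta tau psi s by rewrite mulmxK.
have ts : expR (- t) = expR (- (t - s)) * expR (- s).
  by rewrite -expRD; congr expR; ring.
have taus : expR (- tau s) * expR (tau s) = 1 by rewrite -expRD addNr expR0.
rewrite mx22_mul /switched_solution; congr mx22;
  rewrite ?mul0r ?mulr0 ?addr0 ?add0r //.
- rewrite (expRD (tau s)) ts.
  have -> : delta * (expR (- (t - s)) * ((psi t - psi s) * expR (- tau s))) *
      (expR (tau s) * expR (- s)) = delta * expR (- (t - s)) * (psi t - psi s) *
      (expR (- tau s) * expR (tau s)) * expR (- s) by ring.
  by rewrite taus; ring.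
- by rewrite -expRD; congr expR; ring.
Qed.

Lemma dichotomy_below {R : realType} (delta : R) (T : nat -> R) A tau psi g :
  0 < delta -> breakpoints T -> switched_coefficient delta T A ->
  switching_profile T tau psi -> g < -1 -> dichotomy_with A g 0.
Proof.
move=> d0 bT AE prof g1; exists (switched_solution delta tau psi).
split; first exact: switched_solution_fundamental AE prof.
split; first by rewrite mulmx0.
pose eta := (-1 - g) / 2.
have eta0 : 0 < eta by rewrite divr_gt0 // subr_gt0.
have de0 : 0 <= delta / eta by rewrite divr_ge0 // ltW.
exists (2 + delta / eta), eta; split=> //.
- lra.
- move=> s t _ _; rewrite mulmx0 mul0mx (le_trans op_norm0) //.
  by rewrite mulr_ge0 ?expR_ge0 // addr_ge0.
move=> s t t0 ts; rewrite subr0 mulmx1 switched_solution_transition.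
have [tau1 tau2 psi1 psi2] :=
  switching_profile_increment T tau psi t s bT prof t0 ts.
set h := s - t; have h0 : 0 <= h by rewrite subr_ge0.
have -> : - (t - s) = h by rewrite opprB.
have -> : (g + eta) * (t - s) = h + eta * h by rewrite /eta /h; field.
rewrite [expR (h + eta * h)]expRD [leRHS]mulrCA.
apply: (le_trans (op_norm_mx22 _ _ _ _)).
have eh := expR_ge0 h.
apply: (@le_trans _ _ (expR h * (2 + delta * h))); last first.
  by rewrite ler_wpM2l // affine_le_expR // ltW.
rewrite normr0 add0r !(ger0_norm (expR_ge0 _)) normrM (ger0_norm (ltW d0)).
have e22 : expR (h + (tau t - tau s)) <= expR h.
  by rewrite ler_expR gerDl subr_le0.
have : delta * `|expR h * ((psi t - psi s) * expR (- tau s))| <=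
    delta * (expR h * h).
  rewrite ler_pM2l // normrM (ger0_norm eh) ler_wpM2l // normrM.
  rewrite (ger0_norm (expR_ge0 _)) ler0_norm ?subr_le0 // opprB.
  rewrite expRN ler_pdivrMr ?expR_gt0 // lerBlDl [h * _]mulrC.
  exact: psi2.
lra.
Qed.

Lemma dichotomy_above {R : realType} (delta : R) (T : nat -> R) A tau psi g :
  0 < delta -> breakpoints T -> switched_coefficient delta T A ->
  switching_profile T tau psi -> 0 < g -> dichotomy_with A g 1%:M.
Proof.
move=> d0 bT AE prof g0; exists (switched_solution delta tau psi).
split; first exact: switched_solution_fundamental AE prof.
split; first by rewrite mulmx1.
pose eta := g / 2.
have eta0 : 0 < eta by rewrite divr_gt0.
have de0 : 0 <= delta / eta by rewrite divr_ge0 // ltW.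
exists (2 + delta / eta), eta; split=> //.
- lra.
- move=> s t s0 st; rewrite mulmx1 switched_solution_transition.
  have [tau1 tau2 psi1 psi2] :=
    switching_profile_increment T tau psi s t bT prof s0 st.
  set h := t - s; have h0 : 0 <= h by rewrite subr_ge0.
  have -> : (g - eta) * h = eta * h by rewrite /eta; field.
  apply: (le_trans (op_norm_mx22 _ _ _ _)).
  apply: (@le_trans _ _ (2 + delta * h)); last by rewrite affine_le_expR // ltW.
  rewrite normr0 add0r !(ger0_norm (expR_ge0 _)) normrM (ger0_norm (ltW d0)).
  have e11 : expR (- h) <= 1 by rewrite -[leRHS]expR0 ler_expR oppr_le0.
  have e22 : expR (- h + (tau t - tau s)) <= 1.
    by rewrite -[leRHS]expR0 ler_expR addrC subr_le0 lerBlDl.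
  suff : delta * `|expR (- h) * ((psi t - psi s) * expR (- tau s))| <= delta * h.
    lra.
  rewrite ler_pM2l // ger0_norm; last first.
    by rewrite !mulr_ge0 ?expR_ge0 // subr_ge0.
  apply: (@le_trans _ _ (expR (- h) * (expR (tau t) * h * expR (- tau s)))).
    by rewrite ler_wpM2l ?expR_ge0 // ler_wpM2r ?expR_ge0 // lerBlDl.
  have -> : expR (- h) * (expR (tau t) * h * expR (- tau s)) =
      expR (- h + (tau t - tau s)) * h by rewrite !expRD; ring.
  by rewrite ler_piMl.
- move=> s t _ _; rewrite subrr mulmx0 mul0mx (le_trans op_norm0) //.
  by rewrite mulr_ge0 ?expR_ge0 // addr_ge0.
Qed.

(** By uniqueness, the estimates of a dichotomy can be read on a prescribed
    fundamental matrix. *)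
Lemma dichotomy_with_fundamental {R : realType} {d} (A X : R -> 'M[R]_d) C g P :
  (forall t : R, 0 <= t -> forall i j, `|A t i j| <= C) ->
  fundamental_matrix A X -> dichotomy_with A g P ->
  P *m P = P /\ exists K alpha : R, [/\ 1 <= K, 0 < alpha,
    forall s t : R, 0 <= s -> s <= t ->
      op_norm (X t *m P *m invmx (X s)) <=
        K * expR ((g - alpha) * (t - s)) &
    forall s t : R, 0 <= t -> t <= s ->
      op_norm (X t *m (1%:M - P) *m invmx (X s)) <=
        K * expR ((g + alpha) * (t - s))].
Proof.
move=> AC fX [Y [fY [PP [K [alpha [K1 alpha0 Pdec Qdec]]]]]].
have XY := fundamental_matrix_unique A X Y C AC fX fY.
split=> //; exists K, alpha; split=> // s t.
- by move=> s0 st; rewrite !XY ?(le_trans s0) //; exact: Pdec.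
- by move=> t0 ts; rewrite !XY ?(le_trans t0) //; exact: Qdec.
Qed.

(** Solutions starting in the range of [1 - P] would have exponents larger than
    -1, so this range is zero; with [P = 1], the estimate on [P] fails along the
    odd pieces. *)
Lemma no_dichotomy_between {R : realType} (delta : R) (T : nat -> R) A tau psi C
    g P :
  0 < delta -> breakpoints T -> switched_coefficient delta T A ->
  switching_profile T tau psi ->
  (fun k : nat => T k.+1 - T k) @ \oo --> +oo%R ->
  odd_gaps_negligible T ->
  (forall t : R, 0 <= t -> forall i j, `|A t i j| <= C) ->
  -1 <= g -> g <= 0 -> ~ dichotomy_with A g P.
Proof.
move=> d0 bT AE prof gaps ratio AC g1 g0 dich.
have [T0 Tmono _] := bT; have [tau0 psi0 step] := prof.
pose X := switched_solution delta tau psi.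
have fX : fundamental_matrix A X by exact: switched_solution_fundamental AE prof.
have [PP [K [alpha [K1 alpha0 Pdec Qdec]]]] :=
  dichotomy_with_fundamental A X C g P AC fX dich.
have K0 : 0 < K by exact: lt_le_trans K1.
have Xu s : X s \in unitmx.
  by apply: mx22_unit; rewrite gt_eqF ?expR_gt0.
have X0 : X 0 = 1%:M.
  by rewrite /X /switched_solution tau0 psi0 mulr0 subr0 oppr0 expR0 mx22_1.
have unstable0 v : (1%:M - P) *m v = 0 :> 'cV[R]_2.
  apply/eqP/negPn/negP; set xi := _ *m v => xi0.
  have Qxi : (1%:M - P) *m xi = xi.
    by rewrite /xi mulmxA mulmxBl mul1mx mulmxBr mulmx1 PP subrr subr0.
  have a20 : 0 < alpha / 2 by rewrite divr_gt0.
  have [K' K'0 K'P] :=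
    rescaled_norm_subexponential delta T tau psi xi d0 bT prof ratio _ a20.
  (* [s] is chosen so that [alpha / 2 * s = c], and then [expR c <= c] *)
  pose c := K * K'; have c0 : 0 < c by rewrite mulr_gt0.
  pose s := c / (alpha / 2); have s0 : 0 <= s by rewrite ltW // divr_gt0.
  have n0 : rescaled_norm delta tau psi xi 0 = euclid_norm xi.
    have := switched_solution_norm delta tau psi xi 0.
    by rewrite -/X X0 mul1mx oppr0 expR0 mul1r.
  have back : euclid_norm xi <=
      K * expR ((g + alpha) * (0 - s)) * euclid_norm (X s *m xi).
    have := op_norm_bound (X 0 *m (1%:M - P) *m invmx (X s)) (X s *m xi).
    rewrite -!mulmxA (mulmxA (invmx _)) mulVmx // mul1mx Qxi X0 !mul1mx => le1.
    apply: (le_trans le1); rewrite ler_wpM2r ?euclid_norm_ge0 //.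
    by have := Qdec s 0 (lexx _) s0; rewrite X0 -mulmxA mul1mx.
  have [growth _] := K'P 0 s (lexx _) s0.
  rewrite switched_solution_norm in back.
  have : euclid_norm xi <= c * expR (- c) * euclid_norm xi.
    apply: (le_trans back).
    apply: (@le_trans _ _ (K * expR ((g + alpha) * (0 - s)) * (expR (- s) *
        (K' * expR (alpha / 2 * (s - 0)) * euclid_norm xi)))).
      rewrite ler_wpM2l ?mulr_ge0 ?expR_ge0 ?(ltW K0) // ler_wpM2l ?expR_ge0 //.
      by rewrite -n0.
    have -> : K * expR ((g + alpha) * (0 - s)) * (expR (- s) *
        (K' * expR (alpha / 2 * (s - 0)) * euclid_norm xi)) =
        c * expR ((g + alpha) * (0 - s) + - s + alpha / 2 * (s - 0)) *
        euclid_norm xi by rewrite !expRD /c; ring.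
    rewrite ler_wpM2r ?euclid_norm_ge0 // ler_wpM2l ?(ltW c0) // ler_expR.
    have cE : c = alpha / 2 * s by rewrite /s; field; rewrite gt_eqF.
    have : 0 <= (g + 1) * s by rewrite mulr_ge0 // -lerBlDr sub0r.
    rewrite cE; lra.
  rewrite -[leLHS]mul1r ler_pM2r ?euclid_norm_gt0 //.
  rewrite expRN ler_pdivlMr ?expR_gt0 // mul1r leNgt => /negP; apply.
  by apply: lt_le_trans (expR_ge1Dx _); rewrite ltrDr.
have P1 : P = 1%:M.
  apply/esym/subr0_eq/matrixP => i j; rewrite [RHS]mxE.
  have := unstable0 (delta_mx j 0).
  by rewrite -colE => /colP /(_ i); rewrite !mxE.
have [k0 _ k0P] : \forall k \near \oo, K / alpha <= T k.+1 - T k.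
  by move/cvgryPge: gaps; apply.
pose k := (2 * k0 + 1)%N; set h := T k.+1 - T k.
have hK : K / alpha <= h by apply: k0P; rewrite /= /k; lia.
have Tk0 : 0 <= T k by rewrite -T0 Tmono.
have Tk : T k <= T k.+1 by rewrite Tmono.
have [tauE _] : tau (T k.+1) = tau (T k) + h /\ psi (T k.+1) = psi (T k).
  by have := step k _ _ (lexx _) Tk (lexx _); rewrite /k oddD oddM.
pose w : 'cV[R]_2 := delta_mx 1 0.
have w1 : euclid_norm w <= 1.
  by apply: (le_trans (euclid_norm2_le _)); rewrite !mxE /= normr0 normr1 add0r.
have := Pdec (T k) (T k.+1) Tk0 Tk.
rewrite P1 mulmx1 switched_solution_transition -/h.
set M := mx22 _ _ _ _ => Mdec.
(* over the whole of the odd piece [k], the diagonal entry of index 1 equals 1 *)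
have : 1 <= op_norm M * euclid_norm w.
  apply: (le_trans _ (op_norm_bound M w)).
  apply: (le_trans _ (le_entry_euclid_norm _ 1)).
  rewrite (proj2 (mx22_mulv _ _ _ _ w)) tauE !mxE /= mulr0 add0r mulr1.
  by rewrite ger0_norm ?expR_ge0 // [tau _ + h]addrC addrK addNr expR0.
have : op_norm M * euclid_norm w <= K * expR (- (alpha * h)) * 1.
  apply: (@le_trans _ _ (K * expR ((g - alpha) * h) * euclid_norm w)).
    by rewrite ler_wpM2r ?euclid_norm_ge0.
  apply: ler_pM; rewrite ?mulr_ge0 ?expR_ge0 ?euclid_norm_ge0 ?(ltW K0) //.
  rewrite ler_wpM2l ?(ltW K0) // ler_expR mulrBl gerDr.
  by rewrite mulr_le0_ge0 // subr_ge0.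
rewrite mulr1 => up dn; have := le_trans dn up.
rewrite expRN ler_pdivlMr ?expR_gt0 // mul1r leNgt => /negP; apply.
apply: (lt_le_trans _ (expR_ge1Dx _)).
by move: hK; rewrite ler_pdivrMr // mulrC => hK; lra.
Qed.

Theorem proposition16 (R : realType) (delta : R) (T : nat -> R)
    (A : R -> 'M[R]_2)
    (delta_gt0 : 0 < delta)
    (T_incr : increasing_seq T)
    (T_ge0 : forall k : nat, 0 <= T k)
    (T_0 : T 0%N = 0)
    (T_gap : (fun k : nat => T k.+1 - T k) @ \oo --> +oo%R)
    (T_ratio : (fun k : nat => expR (T (2 * k + 2)%N - T (2 * k + 1)%N) /
                  (T (2 * k + 1)%N - T (2 * k)%N)) @ \oo --> (0 : R))
    (A_even : forall (k : nat) (t : R),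
        T (2 * k)%N <= t -> t < T (2 * k + 1)%N ->
        A t = mx22 (-1) delta 0 (-1))
    (A_odd : forall (k : nat) (t : R),
        T (2 * k + 1)%N <= t -> t < T (2 * k + 2)%N ->
        A t = mx22 (-1) 0 0 0) :
  [/\ bounded_system A,
      Bohl_spectrum A = [set (-1)%:E] &
      Sacker_Sell_spectrum A =
        [set gamma : \bar R | ((-1)%:E <= gamma)%E /\ (gamma <= 0%:E)%E]].
Proof.
have bT := breakpoints_of_gaps T T_0 T_incr T_gap.
have AE : switched_coefficient delta T A.
  move=> k t kt tk; have := odd_double_half k; case: (odd k) => /= kE.
    have [k1 k2] : (2 * k./2 + 1 = k)%N /\ (2 * k./2 + 2 = k.+1)%N by lia.
    by apply: (A_odd k./2); rewrite ?k1 ?k2.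
  have [k0 k1] : (2 * k./2 = k)%N /\ (2 * k./2 + 1 = k.+1)%N by lia.
  by apply: (A_even k./2); rewrite ?k1 ?k0.
have Aval t : 0 <= t -> A t = mx22 (-1) 0 0 0 \/ A t = mx22 (-1) delta 0 (-1).
  move=> t0; have [|k [_ kt tk]] := breakpoint_piece T 0 t bT.
    by rewrite T_0.
  by rewrite (AE k t kt tk); case: (odd k); [left|right].
have A_entry t : 0 <= t -> forall i j, `|A t i j| <= 1 + delta.
  move=> t0 i j; have := ltW delta_gt0 => d0.
  case: (Aval t t0) => ->; rewrite mxE; case: ifP => _; case: ifP => _;
    rewrite ?normrN ?normr1 ?normr0 ?(ger0_norm d0); lra.
have [tau [psi prof]] := switching_profile_exists T bT.
have fX := switched_solution_fundamental delta T A tau psi bT AE prof.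
split.
- exists (2 + delta) => t t0; have d0 := ltW delta_gt0.
  case: (Aval t t0) => ->; apply: (le_trans (op_norm_mx22 _ _ _ _));
    rewrite ?normrN ?normr1 ?normr0 ?(ger0_norm d0); lra.
- have exponent xi X t s : xi != 0 -> fundamental_matrix A X ->
      (forall k, 0 <= t k) -> (forall k, 0 <= s k) ->
      (fun k => t k - s k) @ \oo --> +oo%R ->
      (fun k => ((t k - s k)^-1 *
        ln (euclid_norm (X (t k) *m xi) / euclid_norm (X (s k) *m xi)))%:E)
        @ \oo --> (-1)%:E.
    move=> xi0 fY t0 s0 ts.
    have XE := fundamental_matrix_unique A X _ _ A_entry fY fX.
    have sub := rescaled_norm_subexponential delta T tau psi xi
      delta_gt0 bT prof T_ratio.
    under eq_fun do rewrite !XE // !switched_solution_norm.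
    apply: subexponential_exponent => // x; exact: rescaled_norm_gt0.
  apply/seteqP; split=> [lam [xi xi0 [X [fY [t [s [t0 s0 ts lamE]]]]]]|_ ->].
    exact: cvg_unique lamE (exponent xi X t s xi0 fY t0 s0 ts).
  have xi0 : delta_mx 0 0 != 0 :> 'cV[R]_2.
    by apply/eqP => /matrixP /(_ 0 0) /eqP; rewrite !mxE /= oner_eq0.
  exists (delta_mx 0 0) => //.
  exists (switched_solution delta tau psi); split=> //.
  have ts : (fun k : nat => k%:R - 0 : R) @ \oo --> +oo%R.
    by under eq_fun do rewrite subr0; exact: cvgr_idn.
  exists (fun k => k%:R), (fun=> 0); split=> //.
  by apply: exponent.
- have below g : g < -1 -> dichotomy_with A g 0.
    exact: dichotomy_below delta_gt0 bT AE prof.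
  have above g : 0 < g -> dichotomy_with A g 1%:M.
    exact: dichotomy_above delta_gt0 bT AE prof.
  apply/seteqP; split=> [[g| |] /=|[g| |] /= [g1 g0]].
  + rewrite !lee_fin => nd; split; rewrite leNgt; apply/negP => hg; apply: nd.
      by exists 0; exact: below.
    by exists 1%:M; exact: above.
  + by case; exists 1; exact: above.
  + by case; exists (-2); apply: below; lra.
  + move=> [P]; move: g1 g0; rewrite !lee_fin => g1 g0.
    exact: (no_dichotomy_between delta T A tau psi _ g P delta_gt0 bT AE prof
      T_gap T_ratio A_entry g1 g0).
  + by rewrite leye_eq in g0.
  + by rewrite leeNy_eq in g1.
Qed.
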